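(* Let $\mathcal{P} \subset \Delta(\mathcal{S})^{\mathcal{S}\times\mathcal{A}}$ be a nonempty compact (not necessarily convex) uncertainty set. The following three statements are equivalent. 1. ($\mathcal{P}$ is s-tractable.) For all $\pi \in \Pi_{\mathsf S}$, all $r \in \mathbb{R}^{\mathcal{S}\times\mathcal{A}\times\mathcal{S}}$, all $\gamma \in [0,1)$ and all $\mu \in \Delta(\mathcal{S})$, $$\min_{P \in \mathcal{P}} \mu^\top v^{\pi,P} = \mu^\top u^{\pi}.$$ 2. For all $\pi \in \Pi_{\mathsf S}$, all $r \in \mathbb{R}^{\mathcal{S}\times\mathcal{A}\times\mathcal{S}}$ and all $\gamma \in [0,1)$, there exists $\hat P \in \mathcal{P}$ such that $u^{\pi} = v^{\pi,\hat P}$. 3. (Simultaneous solvability property.) For all $V \in \mathbb{R}^{\mathcal{S}\times\mathcal{A}\times\mathcal{S}}$, $$\bigcap_{s \in \mathcal{S}} \arg\min_{P \in \mathcal{P}} \langle P_s, V_s\rangle \neq \emptyset .$$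
   Context: $\mathcal{S}$ (states) and $\mathcal{A}$ (actions) are finite nonempty sets; $\Delta(E)$ denotes the set of probability distributions on a finite set $E$. An uncertainty set is a subset $\mathcal{P} \subset \Delta(\mathcal{S})^{\mathcal{S}\times\mathcal{A}}$; its elements are written $P=(P_{sa})_{(s,a)}$ with $P_{sa}\in\Delta(\mathcal{S})\subset\mathbb{R}^{\mathcal{S}}$, and $P_s=(P_{sa})_{a\in\mathcal{A}}\in\mathbb{R}^{\mathcal{A}\times\mathcal{S}}$. For $V\in\mathbb{R}^{\mathcal{S}\times\mathcal{A}\times\mathcal{S}}$, $V_s=(V_{sas'})_{a,s'}\in\mathbb{R}^{\mathcal{A}\times\mathcal{S}}$, and $\langle A,B\rangle=\sum_{i,j}A_{ij}B_{ij}$ for matrices. Stationary policies: $\Pi_{\mathsf S}=\Delta(\mathcal{A})^{\mathcal{S}}$, $\pi=(\pi_{sa})$. For rewards $r\in\mathbb{R}^{\mathcal{S}\times\mathcal{A}\times\mathcal{S}}$ (with $r_{sa}=(r_{sas'})_{s'}\in\mathbb{R}^{\mathcal{S}}$), discount factor $\gamma\in[0,1)$, $\pi\in\Pi_{\mathsf S}$ and $P\in\mathcal{P}$, the value function $v^{\pi,P}\in\mathbb{R}^{\mathcal{S}}$ is $v^{\pi,P}_s=\mathbb{E}^{\pi,P}\big[\sum_{t\ge 0}\gamma^t r_{s_ta_ts_{t+1}}\,\big|\,s_0=s\big]$ (with $0^0=1$), where $a_t\sim\pi_{s_t}$ and $s_{t+1}\sim P_{s_ta_t}$; equivalently it is the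 unique solution of $v_s=\sum_a\pi_{sa}P_{sa}^\top(r_{sa}+\gamma v)$ for all $s$. The vector $u^{\pi}\in\mathbb{R}^{\mathcal{S}}$ (depending on $\pi,r,\gamma,\mathcal{P}$) is the unique vector satisfying $u^\pi_s=\min_{P\in\mathcal{P}}\sum_{a\in\mathcal{A}}\pi_{sa}P_{sa}^\top(r_{sa}+\gamma u^\pi)$ for all $s\in\mathcal{S}$. *)

(* Defs.v *)
From HB Require Import structures.
From mathcomp Require Import all_boot all_order all_algebra.
From mathcomp Require Import all_classical all_reals all_analysis.

Set Implicit Arguments.
Unset Strict Implicit.
Unset Printing Implicit Defensive.
Import Order.TTheory GRing.Theory Num.Theory.
Import numFieldNormedType.Exports.

Local Open Scope classical_set_scope.
Local Open Scope ring_scope.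

Definition simplex (R : realType) (E : finType) : set (E -> R) :=
  [set p | (forall x, 0 <= p x) /\ \sum_x p x = 1].

(* Arrays P = (P_{sas'}), i.e. R^{S x A x S}: as the index types are finite, the
   topology of pointwise convergence is the Euclidean one. *)
Notation kernelSpace R S A := {ptws S -> {ptws A -> {ptws S -> R}}}.

Definition kernels (R : realType) (S A : finType) : set (kernelSpace R S A) :=
  [set P | forall s a, simplex (P s a)].

Definition policies (R : realType) (S A : finType) : set (S -> A -> R) :=
  [set pi | forall s, simplex (pi s)].

(* The minimum of f over D exists and equals m. *)
Definition is_min (R : realType) (T : Type) (D : set T) (f : T -> R) (m : R) :=
  (f @` D) m /\ lbound (f @` D) m.

Definition argmin (R : realType) (T : Type) (D : set T) (f : T -> R) : set T :=
  [set x | D x /\ forall y, D y -> f x <= f y].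

Definition frob (R : realType) (I J : finType) (X Y : I -> J -> R) : R :=
  \sum_i \sum_j X i j * Y i j.

Section Trajectories.
Variables (R : realType) (S A : finType).
Implicit Types (r P : S -> A -> S -> R) (pi : S -> A -> R) (s : S) (n : nat).

(* A trajectory of horizon n issued from s is coded by the tuple of the pairs
   (a_t, s_{t+1}) for t < n. *)
Definition state s n (h : n.-tuple (A * S)) (t : nat) : S :=
  nth s (s :: unzip2 h) t.

Definition action n (h : n.-tuple (A * S)) (t : 'I_n) : A := (tnth h t).1.

Definition traj_prob pi P s n (h : n.-tuple (A * S)) : R :=
  \prod_(t < n) (pi (state s h t) (action h t) *
                 P (state s h t) (action h t) (state s h t.+1)).

Definition discounted_return r (gamma : R) s n (h : n.-tuple (A * S)) : R :=
  \sum_(t < n) gamma ^+ t * r (state s h t) (action h t) (state s h t.+1).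

(* Expectation of the sum of the first n discounted rewards given s_0 = s. *)
Definition finite_value r (gamma : R) pi P s n : R :=
  \sum_(h : n.-tuple (A * S)) traj_prob pi P s h * discounted_return r gamma s h.

(* Since rewards are bounded and 0 <= gamma < 1, the expectation of the infinite
   discounted sum is the limit of the expectations of its partial sums. *)
Definition value r (gamma : R) pi P : S -> R :=
  fun s => limn (finite_value r gamma pi P s).

Definition bellman r (gamma : R) pi P (v : S -> R) s : R :=
  \sum_a pi s a * \sum_s' P s a s' * (r s a s' + gamma * v s').

(* The vector u^pi; the default 0 of xget is irrelevant as soon as U is a
   nonempty compact set of kernels, pi a policy and 0 <= gamma < 1. *)
Definition robust_value (U : set (kernelSpace R S A)) r (gamma : R) pi : S -> R :=
  xget (fun=> 0) [set u : S -> R |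
    forall s, is_min U (fun P => bellman r gamma pi P u s) (u s)].

End Trajectories.

Definition s_tractable (R : realType) (S A : finType)
    (U : set (kernelSpace R S A)) : Prop :=
  forall (pi : S -> A -> R) (r : S -> A -> S -> R) (gamma : R) (mu : S -> R),
    policies pi -> 0 <= gamma < 1 -> simplex mu ->
    is_min U (fun P => \sum_s mu s * value r gamma pi P s)
             (\sum_s mu s * robust_value U r gamma pi s).

Definition robust_value_attained (R : realType) (S A : finType)
    (U : set (kernelSpace R S A)) : Prop :=
  forall (pi : S -> A -> R) (r : S -> A -> S -> R) (gamma : R),
    policies pi -> 0 <= gamma < 1 ->
    exists2 P, U P & robust_value U r gamma pi = value r gamma pi P.

Definition simultaneously_solvable (R : realType) (S A : finType)
    (U : set (kernelSpace R S A)) : Prop :=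
  forall V : S -> A -> S -> R,
    \bigcap_(s in [set: S]) argmin U (fun P => frob (P s) (V s)) !=set0.

(* Main.v *)
Require Import Defs.
From HB Require Import structures.
From mathcomp Require Import all_boot all_order all_algebra.
From mathcomp Require Import all_classical all_reals all_analysis.
From mathcomp Require Import lra.

Set Implicit Arguments.
Unset Strict Implicit.
Unset Printing Implicit Defensive.
Import Order.TTheory GRing.Theory Num.Theory.
Import numFieldNormedType.Exports.
Local Open Scope classical_set_scope.
Local Open Scope ring_scope.

(** Both the value of a policy in a fixed kernel and the robust vector u are
    fixed points of operators that are monotone and shrink constants by the
    factor gamma (Blackwell's conditions, [discounting]). Such an operator has
    exactly one fixed point, to which all its iterates converge
    ([discounting_cvg]), and any u with u <= T u lies below that fixed point
    ([discounting_le_fixpoint]).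

    A first-step decomposition of trajectories shows that the n-step values are
    the iterates of the Bellman operator from 0 ([finite_value_iter]); hence
    their limit is the fixed point of that operator ([bellman_value]). The
    pointwise minimum of the Bellman operators over U exists because U is
    compact and the operators are continuous in the kernel; it inherits
    Blackwell's conditions, so the robust vector u satisfies its defining
    equation ([robust_value_is_min]). As u is below its image under the Bellman
    operator of any kernel P in U, it is below the value of P
    ([robust_value_le]); and it equals the value of any P that attains all the
    minima defining u at once ([robust_value_eq_value]).

    The equivalences follow.
    - From s-tractability to attainment: for the uniform initial law, the
      minimal mean value and the mean of u agree, and a kernel whose values
      dominate u everywhere while having the same mean, with positive
      weights, has exactly the values u.
    - From attainment to s-tractability: the mean of u is a lower bound
      since u is below every value, and it is attained.
    - From simultaneous solvability to attainment: with V_{sas'} = pi_{sa}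
      (r_{sas'} + gamma u_{s'}), the s-component of the Bellman operator at
      u is the pairing of P_s with V_s, so a kernel that minimizes all the
      pairings attains all the minima defining u.
    - From attainment to simultaneous solvability: for gamma = 0, the
      uniform policy and rewards |A| V, values are the pairings of P_s with
      V_s and u is the vector of their minima. *)

(** * Discounting operators *)

(** Blackwell's conditions in one inequality: [c = 0] is monotonicity. The sign
    of [c] is free, and no absolute value occurs, so that the same inequality
    serves both to compare fixed points and to bound distances. *)
Definition discounting (R : realType) (S : finType) (gamma : R)
    (T : (S -> R) -> S -> R) : Prop :=
  forall (u w : S -> R) (c : R), (forall s, u s <= w s + c) ->
  forall s, T u s <= T w s + gamma * c.

Section DiscountingOperators.
Variables (R : realType) (S : finType) (gamma : R) (T : (S -> R) -> S -> R).
Hypothesis T_disc : discounting gamma T.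
Implicit Types (u v w : S -> R) (s : S) (n : nat).

Lemma discounting_dist u w (c : R) :
  (forall s, `|u s - w s| <= c) -> forall s, `|T u s - T w s| <= gamma * c.
Proof.
move=> uw s.
have Huw : T u s <= T w s + gamma * c.
  by apply: T_disc => x; rewrite addrC -lerBlDr (le_trans (ler_norm _)).
have Hwu : T w s <= T u s + gamma * c.
  by apply: T_disc => x; rewrite addrC -lerBlDr (le_trans (ler_norm _))// distrC.
by rewrite ler_distl; apply/andP; split; rewrite ?lerBlDr.
Qed.

(** At a state where [u - v] is largest, with value [c], the operator yields
    [c <= gamma * c], which forces [c <= 0]. *)
Lemma discounting_le_fixpoint u v : gamma < 1 ->
  (forall s, u s <= T u s) -> T v = v -> forall s, u s <= v s.
Proof.
move=> gamma1 uTu Tv s.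
case: (@arg_maxP _ _ _ s xpredT (fun x => u x - v x) isT) => m _ maxm.
have := @T_disc u v (u m - v m) _ m; rewrite Tv => /(_ _)/(le_trans (uTu m)) le_m.
have {}le_m : u m <= v m + gamma * (u m - v m).
  by apply: le_m => x; rewrite addrC -lerBlDr; exact: maxm.
have : (1 - gamma) * (u m - v m) <= 0 by rewrite mulrBl mul1r; lra.
rewrite pmulr_rle0 ?subr_gt0// => um_le_vm.
by rewrite -subr_le0; apply: le_trans um_le_vm; exact: maxm.
Qed.

Lemma discounting_fixpoint_unique u v :
  gamma < 1 -> T u = u -> T v = v -> u = v.
Proof.
move=> gamma1 Tu Tv; apply/funext => s; apply/eqP.
by rewrite eq_le !discounting_le_fixpoint// => x; rewrite ?Tu ?Tv.
Qed.

(** Banach's argument, coordinate by coordinate: successive iterates are at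
    distance at most [c * gamma ^+ n], so each coordinate is dominated by a
    geometric series, and passing to the limit in the recursion gives a fixed
    point. *)
Lemma discounting_cvg u : 0 <= gamma < 1 ->
  exists2 v, T v = v & forall s, iter n T u s @[n --> \oo] --> v s.
Proof.
move=> /andP[gamma0 gamma1].
(* The sum dominates every coordinate, so it serves as the supremum norm. *)
pose c := \sum_s `|T u s - u s|.
have step n s : `|iter n.+1 T u s - iter n T u s| <= geometric c gamma n.
  elim: n s => [|n IHn] s /=.
    by rewrite expr0 mulr1 /c (bigD1 s)//= lerDl sumr_ge0.
  by rewrite exprS mulrCA; exact: discounting_dist.
have cvg_iter s : cvgn (fun n => iter n T u s).
  have -> : (fun n => iter n T u s) =
      cst (u s) + series (telescope (fun n => iter n T u s)).
    by apply/funext => n; rewrite telescopeK [RHS]addrC subrK.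
  apply: is_cvgD; first exact: is_cvg_cst.
  apply: normed_cvg; apply: (@series_le_cvg _ _ (geometric c gamma)).
  - by move=> n /=.
  - by move=> n; rewrite /= mulr_ge0 ?exprn_ge0// sumr_ge0.
  - by move=> n; exact: step.
  - by apply: is_cvg_geometric_series; rewrite ger0_norm.
pose v s := limn (fun n => iter n T u s).
have iter_v s : iter n T u s @[n --> \oo] --> v s by exact: cvg_iter.
exists v => //; apply/funext => s.
have dist0 : (gamma * \sum_x `|iter n T u x - v x|) @[n --> \oo] --> 0.
  rewrite -[X in _ --> X](mulr0 gamma); apply: cvgM; first exact: cvg_cst.
  rewrite [X in _ --> X](_ : _ = \sum_(x : S) `|v x - v x|); last first.
    by rewrite big1// => x _; rewrite subrr normr0.
  apply: (cvg_big (@add_continuous R)) => x _.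
  by apply: cvg_norm; apply: cvgB => //; exact: cvg_cst.
(* The shifted iterates converge both to [T v s] and to [v s]. *)
have iter_Tv : iter n.+1 T u s @[n --> \oo] --> T v s.
  apply/subr_cvg0; apply/norm_cvg0P.
  apply: (squeeze_cvgr _ (cvg_cst 0) dist0); near=> n.
  rewrite normr_ge0 iterS/=; apply: discounting_dist => x.
  by rewrite (bigD1 x)//= lerDl sumr_ge0.
rewrite -(cvg_lim (@Rhausdorff R) iter_Tv).
by apply: cvg_lim => //; rewrite (cvg_shiftS (fun n => iter n T u s)).
Unshelve. all: by end_near.
Qed.

End DiscountingOperators.

(** * Values are fixed points of the Bellman operator *)

Lemma sum_tuple_cons (R : nmodType) (X : finType) n (F : n.+1.-tuple X -> R) :
  \sum_h F h = \sum_x \sum_(h : n.-tuple X) F [tuple of x :: h].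
Proof.
rewrite pair_big/= (reindex (fun p : X * n.-tuple X => [tuple of p.1 :: p.2]))//=.
exists (fun h : n.+1.-tuple X => (thead h, [tuple of behead h])) => [[x h] _|h _].
  by rewrite /= theadE; congr (_, _); exact/val_inj.
by rewrite [RHS]tuple_eta.
Qed.

Section Evaluation.
Variables (R : realType) (S A : finType).
Implicit Types (r P : S -> A -> S -> R) (pi : S -> A -> R) (s : S) (n : nat).
Implicit Types (u v : S -> R).

(** The two sides read the tuple with different default values, [s] and [x.2],
    hence the restriction to times within the horizon. *)
Lemma state_cons s (x : A * S) n (h : n.-tuple (A * S)) t : (t <= n)%N ->
  state s [tuple of x :: h] t.+1 = state x.2 h t.
Proof.
by move=> le_tn; apply: set_nth_default; rewrite /= size_map size_tuple ltnS.
Qed.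

Lemma traj_prob_cons pi P s (x : A * S) n (h : n.-tuple (A * S)) :
  traj_prob pi P s [tuple of x :: h] =
  pi s x.1 * P s x.1 x.2 * traj_prob pi P x.2 h.
Proof.
rewrite /traj_prob big_ord_recl /action tnth0; congr (_ * _).
by apply: eq_bigr => t _; rewrite tnthS lift0 !state_cons// ltnW.
Qed.

Lemma discounted_return_cons r (gamma : R) s (x : A * S) n
    (h : n.-tuple (A * S)) :
  discounted_return r gamma s [tuple of x :: h] =
  r s x.1 x.2 + gamma * discounted_return r gamma x.2 h.
Proof.
rewrite /discounted_return big_ord_recl /action tnth0 expr0 mul1r.
congr (_ + _); rewrite mulr_sumr; apply: eq_bigr => t _.
by rewrite tnthS lift0 exprS mulrA !state_cons// ltnW.
Qed.

Lemma sum_traj_prob pi P s n : policies pi -> kernels P ->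
  \sum_(h : n.-tuple (A * S)) traj_prob pi P s h = 1.
Proof.
move=> piP PP; elim: n s => [|n IHn] s.
  rewrite (big_pred1 [tuple]) ?/traj_prob ?big_ord0// => h.
  by rewrite [h]tuple0 /= eqxx.
rewrite sum_tuple_cons.
under eq_bigr => x _.
  under eq_bigr do rewrite traj_prob_cons.
  rewrite -mulr_sumr IHn mulr1; over.
rewrite -(pair_bigA _ (fun a s' => pi s a * P s a s'))/=.
under eq_bigr => a _ do rewrite -mulr_sumr (PP s a).2 mulr1.
exact: (piP s).2.
Qed.

(** The first transition contributes its reward with the total weight of the
    continuations, which is 1; the remaining return is discounted once and
    averages to the value with one step less, started from the next state. *)
Lemma finite_value_iter r (gamma : R) pi P s n : policies pi -> kernels P ->
  finite_value r gamma pi P s n = iter n (bellman r gamma pi P) (fun=> 0) s.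
Proof.
move=> piP PP; elim: n s => [|n IHn] s.
  rewrite /finite_value big1// => h _.
  by rewrite /discounted_return big_ord0 mulr0.
rewrite /finite_value sum_tuple_cons iterS /bellman.
under [RHS]eq_bigr do rewrite mulr_sumr.
rewrite [RHS]pair_big/=; apply: eq_bigr => x _; rewrite -IHn.
under eq_bigr do rewrite traj_prob_cons discounted_return_cons mulrDr.
rewrite big_split/=.
under eq_bigr do rewrite mulrAC.
rewrite -mulr_sumr sum_traj_prob// mulr1.
under [X in _ + X]eq_bigr do rewrite -mulrA [_ * (gamma * _)]mulrCA.
by rewrite -!mulr_sumr -mulrDr mulrA.
Qed.

Lemma bellman_discounting r (gamma : R) pi P : 0 <= gamma ->
  policies pi -> kernels P -> discounting gamma (bellman r gamma pi P).
Proof.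
move=> gamma0 piP PP u w c uw s.
have -> : gamma * c = \sum_a pi s a * \sum_s' P s a s' * (gamma * c).
  under eq_bigr do rewrite -mulr_suml (PP _ _).2 mul1r.
  by rewrite -mulr_suml (piP s).2 mul1r.
rewrite /bellman -big_split/=; apply: ler_sum => a _.
rewrite -mulrDr ler_wpM2l ?(piP s).1//.
rewrite -big_split/=; apply: ler_sum => s' _.
rewrite -mulrDr ler_wpM2l ?(PP s a).1// -addrA lerD2l -mulrDr.
exact: ler_wpM2l.
Qed.

Lemma bellman_value r (gamma : R) pi P : 0 <= gamma < 1 ->
  policies pi -> kernels P ->
  bellman r gamma pi P (value r gamma pi P) = value r gamma pi P.
Proof.
move=> gamma01 piP PP; have /andP[gamma0 _] := gamma01.
have [v Tv cvgv] :=
  discounting_cvg (bellman_discounting r gamma0 piP PP) (fun=> 0) gamma01.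
suff -> : value r gamma pi P = v by [].
apply/funext => s; apply: cvg_lim => //.
rewrite (_ : finite_value _ _ _ _ _ =
  fun n => iter n (bellman r gamma pi P) (fun=> 0) s) //.
by apply/funext => n; rewrite finite_value_iter.
Qed.

End Evaluation.

(** * The robust Bellman equation *)

Lemma is_min_unique (R : realType) (T : Type) (D : set T) (f : T -> R) m m' :
  is_min D f m -> is_min D f m' -> m = m'.
Proof.
by move=> [fm lbm] [fm' lbm']; apply/eqP; rewrite eq_le lbm// lbm'.
Qed.

Section RobustEvaluation.
Variables (R : realType) (S A : finType) (U : set (kernelSpace R S A)).
Hypotheses (U_kernels : U `<=` @kernels R S A) (U_neq0 : U !=set0).
Hypothesis U_compact : compact U.
Implicit Types (r : S -> A -> S -> R) (pi : S -> A -> R) (s : S).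
Implicit Types (P : kernelSpace R S A) (u v : S -> R).

Lemma bellman_continuous r (gamma : R) pi u s :
  continuous (fun P : kernelSpace R S A => bellman r gamma pi P u s).
Proof.
have coordinate a s' : continuous (fun P : kernelSpace R S A => P s a s').
  move=> P.
  have ev_s := @proj_continuous S (fun=> {ptws A -> {ptws S -> R}}) s P.
  have ev_a := @proj_continuous A (fun=> {ptws S -> R}) a (P s).
  have ev_s' := @proj_continuous S (fun=> R) s' (P s a).
  exact: cvg_comp _ _ (cvg_comp _ _ ev_s ev_a) ev_s'.
move=> P; have nbhsP := @nbhs_filter (kernelSpace R S A) P.
apply: (cvg_big (@add_continuous R)) => a _.
apply: cvgM; first exact: cvg_cst.
apply: (cvg_big (@add_continuous R)) => s' _.
by apply: cvgM; [exact: coordinate | exact: cvg_cst].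
Qed.

Lemma bellman_is_min r (gamma : R) pi u s :
  exists m, is_min U (fun P => bellman r gamma pi P u s) m.
Proof.
have [P UP leP] := compact_EVT_min U_neq0 U_compact
  (continuous_subspaceT (@bellman_continuous r gamma pi u s)).
exists (bellman r gamma pi P u s); split.
  by exists P => //; rewrite -in_setE.
by move=> _ [Q UQ <-]; apply: leP; rewrite in_setE.
Qed.

(** The robust Bellman equation has a solution: the
    pointwise minimum [T] of the Bellman operators is discounting, because a
    kernel minimizing for [w] is a competitor for [u], and so has a fixed
    point. *)
Lemma robust_value_is_min r (gamma : R) pi : policies pi -> 0 <= gamma < 1 ->
  forall s, is_min U (fun P => bellman r gamma pi P (robust_value U r gamma pi) s)
                     (robust_value U r gamma pi s).
Proof.
move=> piP gamma01; have /andP[gamma0 _] := gamma01.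
pose T u s := xget 0 (is_min U (fun P => bellman r gamma pi P u s)).
have T_min u s : is_min U (fun P => bellman r gamma pi P u s) (T u s).
  by apply: xgetPex; exact: bellman_is_min.
have T_disc : discounting gamma T.
  move=> u w c uw s; have [[P UP <-] _] := T_min w s.
  apply: (@le_trans _ _ (bellman r gamma pi P u s)).
    by apply: (T_min u s).2; exists P.
  exact: (bellman_discounting r gamma0 piP (U_kernels UP)).
have [u Tu _] := discounting_cvg T_disc (fun=> 0) gamma01.
apply: (@xgetPex _ (fun=> 0) [set u : S -> R |
  forall s, is_min U (fun P => bellman r gamma pi P u s) (u s)]).
by exists u => s; rewrite -[X in is_min _ _ (X s)]Tu.
Qed.

(** The robust vector is below its image under the Bellman operator of [P], as
    [P] is one of the kernels over which the minimum is taken. *)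
Lemma robust_value_le r (gamma : R) pi P s : policies pi -> 0 <= gamma < 1 ->
  U P -> robust_value U r gamma pi s <= value r gamma pi P s.
Proof.
move=> piP gamma01 UP; have /andP[gamma0 gamma1] := gamma01.
apply: (discounting_le_fixpoint
  (bellman_discounting r gamma0 piP (U_kernels UP))) => //.
- by move=> x; apply: (robust_value_is_min r piP gamma01 x).2; exists P.
- by apply: bellman_value => //; exact: U_kernels.
Qed.

(** If one kernel attains the minimum at every state, the robust equation is the
    Bellman equation of that kernel, whose solution is unique. *)
Lemma robust_value_eq_value r (gamma : R) pi P :
  policies pi -> 0 <= gamma < 1 -> U P ->
  (forall s, argmin U
     (fun Q => bellman r gamma pi Q (robust_value U r gamma pi) s) P) ->
  robust_value U r gamma pi = value r gamma pi P.
Proof.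
move=> piP gamma01 UP minP; have /andP[gamma0 gamma1] := gamma01.
have PP := U_kernels UP.
apply: (discounting_fixpoint_unique (bellman_discounting r gamma0 piP PP)) => //.
  apply/funext => s; apply: is_min_unique (robust_value_is_min r piP gamma01 s).
  split; first by exists P.
  by move=> _ [Q UQ <-]; exact: (minP s).2.
exact: bellman_value.
Qed.

End RobustEvaluation.

(** * The equivalences *)

Lemma uniform_simplex (R : realType) (E : finType) : (0 < #|E|)%N ->
  simplex (fun _ : E => #|E|%:R^-1 : R).
Proof.
move=> E_gt0; split=> [_|]; first by rewrite invr_ge0.
by rewrite sumr_const -[LHS]mulr_natl divff// pnatr_eq0 -lt0n.
Qed.

Section Equivalences.
Variables (R : realType) (S A : finType) (U : set (kernelSpace R S A)).
Hypotheses (U_kernels : U `<=` @kernels R S A) (U_neq0 : U !=set0).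
Hypothesis U_compact : compact U.

(** All the weights of the uniform law are positive, so the nonnegative gaps
    between value and robust value vanish as soon as their mean does. *)
Lemma s_tractable_attained : (0 < #|S|)%N ->
  s_tractable U -> robust_value_attained U.
Proof.
move=> S_gt0 tractU pi r gamma piP gamma01.
have [[P UP eq_mean] _] :=
  tractU pi r gamma _ piP gamma01 (uniform_simplex R S_gt0).
exists P => //; apply/funext => s; apply/esym/eqP; rewrite -subr_eq0.
have gap_ge0 x : true ->
    0 <= value r gamma pi P x - robust_value U r gamma pi x.
  by rewrite subr_ge0 robust_value_le.
have weight_neq0 : #|S|%:R^-1 != 0 :> R by rewrite invr_eq0 pnatr_eq0 -lt0n.
move: eq_mean; rewrite -!mulr_sumr => /(mulfI weight_neq0)/eqP.
rewrite -subr_eq0 -sumrB psumr_eq0// => /allP/(_ s).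
by rewrite mem_index_enum => /(_ isT).
Qed.

Lemma attained_s_tractable : robust_value_attained U -> s_tractable U.
Proof.
move=> attU pi r gamma mu piP gamma01 muP.
have [P UP uP] := attU pi r gamma piP gamma01.
split; first by exists P; rewrite ?uP.
move=> _ [Q UQ <-]; apply: ler_sum => s _.
by apply: ler_wpM2l; [exact: muP.1 | exact: robust_value_le].
Qed.

(** The array [V] is the one for which pairing with [P s] computes the Bellman
    operator of [P] at the robust vector; it is fixed before [P] is chosen
    since this vector involves no particular kernel. *)
Lemma solvable_attained : (0 < #|S|)%N ->
  simultaneously_solvable U -> robust_value_attained U.
Proof.
move=> /card_gt0P[s0 _] solvU pi r gamma piP gamma01.
pose u := robust_value U r gamma pi.
pose V s a s' := pi s a * (r s a s' + gamma * u s').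
have bellmanE (Q : kernelSpace R S A) s :
    bellman r gamma pi Q u s = frob (Q s) (V s).
  apply: eq_bigr => a _; rewrite mulr_sumr.
  by apply: eq_bigr => s' _; rewrite mulrCA.
have [P minP] := solvU V.
exists P; first exact: (minP s0 I).1.
apply: robust_value_eq_value => //; first exact: (minP s0 I).1.
move=> s; split=> [|Q UQ]; first exact: (minP s0 I).1.
by rewrite -/u !bellmanE; exact: (minP s I).2.
Qed.

(** With discount 0 the continuation disappears and the Bellman operator is the
    expected immediate reward, which is an arbitrary pairing: the factor [#|A|]
    in the rewards cancels the uniform weights of the policy. *)
Lemma attained_solvable : (0 < #|A|)%N ->
  robust_value_attained U -> simultaneously_solvable U.
Proof.
move=> A_gt0 attU V.
pose pi (_ : S) (_ : A) : R := #|A|%:R^-1.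
pose r s a s' := #|A|%:R * V s a s'.
have piP : policies pi by move=> s; exact: uniform_simplex.
have gamma01 : 0 <= (0 : R) < 1 by rewrite lexx ltr01.
have bellmanE Q v s : bellman r 0 pi Q v s = frob (Q s) (V s).
  apply: eq_bigr => a _; rewrite mulr_sumr; apply: eq_bigr => s' _.
  by rewrite mul0r addr0 mulrCA mulKf// pnatr_eq0 -lt0n.
have [P UP uP] := attU pi r 0 piP gamma01.
exists P => s _; split=> // Q UQ.
rewrite -(bellmanE P (value r 0 pi P)) bellman_value//; last exact: U_kernels.
rewrite -uP -(bellmanE Q (robust_value U r 0 pi)).
by apply: (robust_value_is_min U_kernels U_neq0 U_compact r piP gamma01 s).2; exists Q.
Qed.
End Equivalences.

Theorem theorem1 (R : realType) (S A : finType)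
    (S_gt0 : (0 < #|S|)%N) (A_gt0 : (0 < #|A|)%N)
    (U : set (kernelSpace R S A)) (U_kernels : U `<=` @kernels R S A)
    (U_neq0 : U !=set0) (U_compact : compact U) :
  (s_tractable U <-> robust_value_attained U) /\
  (robust_value_attained U <-> simultaneously_solvable U).
Proof.
split; split.
- exact: s_tractable_attained.
- exact: attained_s_tractable.
- exact: attained_solvable.
- exact: solvable_attained.
Qed.
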